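(* Let $K$ be a finite simplicial complex of dimension $r$ with $r\ge 1$. Then $$\lambda_{\max}\bigl(L^{\mathrm{up}}_{r-1}(K)\bigr)\le \max_{F\in S_r(K)}\Bigl|\bigcup_{E\in\partial F}N_K(E)\Bigr| .$$
   Context: A finite (abstract) simplicial complex is a collection of finite sets closed under inclusion; an $r$-face is a face of cardinality $r+1$; $S_r(K)$ is the set of $r$-faces of $K$; $V(K)$ is the vertex set; the dimension of $K$ is the maximum dimension of its faces. Chain groups and boundary: choose an orientation (an ordering of the vertices up to even permutation) for each face, written $[F]$. $C_r(K,\mathbb{R})$ is the real vector space with basis $B_r(K)=\{[F]:F\in S_r(K)\}$, with the inner product making $B_r(K)$ orthonormal. The boundary map $\partial_r:C_r(K,\mathbb{R})\to C_{r-1}(K,\mathbb{R})$ is $\partial_r[v_0,\ldots,v_r]=\sum_{j=0}^r(-1)^j[v_0,\ldots,\widehat{v_j},\ldots,v_r]$, and $\partial_r^*$ is its adjoint. The combinatorial $(r-1)$-up Laplacian is $L^{\mathrm{up}}_{r-1}(K)=\partial_r\partial_r^*$ acting on $C_{r-1}(K,\mathbb{R})$; $\lambda_{\max}$ denotes its largest eigenvalue. For an $r$-face $F$, $\partial F$ denotes the set of all $(r-1)$-faces contained in $F$. For an $(r-1)$-face $E$ of $K$, $$N_K(E)=\{u\in V(K)\setminus E: E\cup\{u\}\in S_r(K)\}.$$ *)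

(* Defs.v *)
From mathcomp Require Import all_boot all_order all_fingroup all_algebra.
From mathcomp Require Import classical_sets reals complex.

Set Implicit Arguments.
Unset Strict Implicit.
Unset Printing Implicit Defensive.

Import Order.TTheory GRing.Theory Num.Theory.

Section SimplicialComplex.
Variable T : finType.
Implicit Types (K : {set {set T}}) (E F : {set T}) (r : nat) (s t : seq T).

(* T is only an ambient finite set: elements of T need not be vertices of K. *)
Definition simplicial_complex K : Prop :=
  forall E F, F \in K -> E \subset F -> E \in K.

Definition faces K r : {set {set T}} := [set F in K | #|F| == r.+1].

Definition vertices K : {set T} := [set v | [set v] \in K].

(* Predecessor and \max are truncated at 0, so this is the usual dimension    *)
(* except that the empty complex and {set0} get dimension 0 instead of < 0.   *)
Definition complex_dim K : nat := \max_(F in K) #|F|.-1.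

(* The faces of K of dimension r - 1 that lie in the r-face F. *)
Definition facets K r F : {set {set T}} := [set E in faces K r.-1 | E \subset F].

(* For an (r-1)-face E of K. *)
Definition nbrs K r E : {set T} :=
  [set u in vertices K :\: E | u |: E \in faces K r].

(* An orientation of each face, given by an ordering that represents it. *)
Definition orientation K (o : {set T} -> seq T) : Prop :=
  forall F, F \in K -> perm_eq (o F) (enum F).

Definition same_orientation s t : bool :=
  [exists p : {perm T},
     [&& perm_on [set x in t] p, map p t == s & ~~ odd_perm p]].

End SimplicialComplex.

Local Open Scope ring_scope.

Section Chains.
Variables (R : realType) (T : finType).
Variables (K : {set {set T}}) (o : {set T} -> seq T).

(* C_r(K, R) is 'rV[R]_#|faces K r|; coordinate i is the coefficient of the   *)
(* basis element [F] with F = enum_val i, oriented by o F.                    *)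
(* oriented_face r s is the chain [s_0, ..., s_r], that is, [F] or -[F] when  *)
(* s is an ordering of the vertices of F.                                     *)
Definition oriented_face (r : nat) (s : seq T) : 'rV[R]_#|faces K r| :=
  \row_i (let t := o (enum_val i) in
          if perm_eq s t then (if same_orientation s t then 1 else -1) else 0).

(* Linear maps act on row vectors from the right, c |-> c *m M, as for        *)
(* eigenvalue, so row i is the image of the i-th oriented r-face.             *)
Definition boundary (r : nat) : 'M[R]_(#|faces K r|, #|faces K r.-1|) :=
  \matrix_i (let s := o (enum_val i) in
             \sum_(j < r.+1)
                (-1) ^+ j *: oriented_face r.-1 (take j s ++ drop j.+1 s)).

(* The composite of the adjoint of the boundary map of degree k + 1, followed *)
(* by that boundary map; the bases are orthonormal, so the adjoint is the     *)
(* transpose, and maps compose from left to right.                            *)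
Definition up_laplacian (k : nat) : 'M[R]_#|faces K k| :=
  (boundary k.+1)^T *m boundary k.+1.

End Chains.

Definition lambda_max (R : realType) (n : nat) (A : 'M[R]_n) : R :=
  sup [set a : R | eigenvalue A a]%classic.

Lemma symmetric_eigenvalue (R : realType) (n : nat) (A : 'M[R]_n) :
  (0 < n)%N -> A^T = A -> exists a, eigenvalue A a.
Proof.
case: n A => // n A _ symA.
pose B := map_mx (real_complex R) A.
have Bherm : B \is hermsymmx.
  apply: realsym_hermsym.
    by apply/is_hermitianmxP; rewrite expr0 scale1r map_mx_id // /B map_trmx symA.
  by apply/mxOverP => i j; rewrite mxE complex_real.
have /mxOverP/(_ 0 ord0) := hermitian_spectral_diag_real Bherm.
case/complex_realP => a Da.
exists a; rewrite -(eigenvalue_map (real_complex R)).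
have /orthomx_spectralP DB := hermitian_normalmx Bherm.
have Pu := unitarymx_unit (spectral_unitarymx B).
apply/eigenvalueP; exists (row 0 (spectralmx B)); last first.
  apply/eqP => row0.
  have : row 0 (spectralmx B *m invmx (spectralmx B)) = 0.
    by rewrite row_mul row0 mul0mx.
  rewrite mulmxV // => /matrixP /(_ 0 0) /eqP.
  by rewrite !mxE eqxx oner_eq0.
change (map_mx _ A) with B.
rewrite -row_mul {2}DB !mulmxA mulmxV // mul1mx.
by rewrite row_mul row_diag_mx -scalemxAl -rowE Da.
Qed.

Lemma lambda_max_eigenvalue (R : realType) (n : nat) (A : 'M[R]_n) :
  (0 < n)%N -> A^T = A ->
  eigenvalue A (lambda_max A) /\
  (forall a, eigenvalue A a -> a <= lambda_max A).
Proof.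
move=> n_gt0 symA; have [a0 a0P] := symmetric_eigenvalue n_gt0 symA.
have [s sP] : exists s : seq R, forall a, eigenvalue A a -> a \in s.
  have [rs Drs] := closed_field_poly_normal
    (map_poly (real_complex R) (char_poly A)).
  exists (map (@complex.Re R) rs) => a; rewrite eigenvalue_root_char => ra.
  apply/mapP; exists (real_complex R a) => //.
  have : root (map_poly (real_complex R) (char_poly A)) (real_complex R a).
    by rewrite fmorph_root.
  rewrite Drs rootZ ?root_prod_XsubC // lead_coef_map.
  by rewrite (eqP (char_poly_monic A)) rmorph1 oner_eq0.
have [m mA mub] : exists2 m, eigenvalue A m & forall a, eigenvalue A a -> a <= m.
  suff [m mA mub] : exists2 m, eigenvalue A m &
      forall a, a \in s -> eigenvalue A a -> a <= m.
    by exists m => // a aA; apply: mub => //; apply: sP.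
  elim: s {sP} => [|x s [m mA mub]]; first by exists a0.
  have [xA|xA] := boolP (eigenvalue A x); last first.
    exists m => // a; rewrite inE => /orP[/eqP -> aA|]; last exact: mub.
    by rewrite aA in xA.
  have [lexm|ltmx] := leP x m.
    by exists m => // a; rewrite inE => /orP[/eqP -> //|]; exact: mub.
  exists x => // a; rewrite inE => /orP[/eqP -> //|sa aA].
  by apply: le_trans (ltW ltmx); apply: mub.
suff -> : lambda_max A = m by [].
apply/eqP; rewrite eq_le; apply/andP; split.
  by apply: ge_sup; [exists m | move=> a /= /mub].
apply: sup_upper_bound => //; split; first by exists m.
by exists m => a /= /mub.
Qed.

Lemma up_laplacian_sym (R : realType) (T : finType) (K : {set {set T}})
    (o : {set T} -> seq T) (k : nat) :
  (up_laplacian R K o k)^T = up_laplacian R K o k.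
Proof. by rewrite /up_laplacian trmx_mul trmxK. Qed.

(* Main.v *)
Require Import Defs.
From mathcomp Require Import all_boot all_order all_fingroup all_algebra.
From mathcomp Require Import reals ring.
From mathcomp Require boolp classical_sets.

Set Implicit Arguments.
Unset Strict Implicit.
Unset Printing Implicit Defensive.

Import Order.TTheory GRing.Theory Num.Theory.
Local Open Scope ring_scope.

(** Write B for the matrix of the boundary map on chains of degree r.  The
up-Laplacian is B^T B, and its eigenvalues are at most c >= 0 as soon as
|w B|^2 <= c |w|^2 for every r-chain w ([lambda_max_gram_le]).

To bound |w B|^2, view w as a function f on all subsets of the ambient set T,
zero outside the set S of r-faces.  In the full simplex on T the boundary
operator d and its adjoint, the coboundary d*, are sums over the points x of
T of the operators [contract x] and [wedge x].  These satisfy the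
Clifford relations ([contract_wedge]), so d d* + d* d = #|T| and
    |d f|^2 = #|T| |f|^2 - |d* f|^2     ([bd_cobd_norm]).
It remains to bound |d* f|^2 from below.  If a set G contains exactly one
member F = G - u of S, then (d* f)(G) = +- f(F); keeping only such G gives
    |d* f|^2 >= sum over F of #{u | F is the only facet of F + u in S} f(F)^2
([cobd_sole_facet]).  Subtracting, the weight left on f(F)^2 is the number of
points u that are in F or for which F + u has a second facet (F + u) - v in S.
Every such u is a neighbour of a facet of F, namely of F - u if u is in F and
of F - v otherwise ([not_sole_facet_nbrs]), so this weight is at most the
cardinality of the union of the neighbourhoods in the theorem.

The remaining work is to match signs: the matrix B is defined from an
arbitrary orientation of the faces, while d uses a fixed linear order of T.
The two differ by the diagonal sign change F |-> sign of the ordering o F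
([boundaryE]), which does not affect norms. *)

(** * Inversion parity and orientations *)

Section Inversions.
Variable T : finType.
Implicit Types (x y : T) (s t a b : seq T).

(** An arbitrary linear order on [T], fixed to compare orientations. *)
Definition prec y x := (enum_rank y < enum_rank x)%N.

Lemma precxx x : prec x x = false.
Proof. exact: ltnn. Qed.

Lemma prec_neq x y : x != y -> prec y x = ~~ prec x y.
Proof.
move=> nxy; rewrite /prec -leqNgt ltn_neqAle.
by rewrite (inj_eq val_inj) (inj_eq enum_rank_inj) eq_sym nxy.
Qed.

Fixpoint inversions s : bool :=
  if s is x :: s' then odd (count (prec^~ x) s') (+) inversions s' else false.

(** An entry [y] before [x] contributes an inversion when it is larger than
[x], and one after [x] when it is smaller.  Modulo 2 this is the number of
entries before [x] plus the number of all entries smaller than [x]. *)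
Lemma inversions_remove a x b : x \notin a ->
  inversions (a ++ x :: b) =
    odd (size a) (+) odd (count (prec^~ x) (a ++ b)) (+) inversions (a ++ b).
Proof.
elim: a => [|y a IH] //=; rewrite inE negb_or => /andP[nxy xa].
rewrite IH // !count_cat /= !oddD !oddb (prec_neq nxy).
move: (odd _) (odd _) (odd _) (odd _) (odd _) (inversions _) (prec x y).
by do 7!case.
Qed.

(** The parity of a permutation is the change in inversion parity.  To move
the head [y] of [s] to the head of [t = x :: a ++ y :: b], exchange the
values [x] and [y]; then the tails are rearranged by induction. *)
Lemma orienting_perm s t : uniq t -> perm_eq s t ->
  exists2 p : {perm T}, perm_on [set x in t] p /\ map p t = s &
    odd_perm p = inversions s (+) inversions t.
Proof.
elim: s t => [|y s IH] t Ut.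
  rewrite perm_sym => /perm_nilP ->; exists 1%g; last by rewrite odd_perm1.
  by split=> //; exact: perm_on1.
case: t Ut => [_ /perm_nilP //|x t] /= /andP[xt Ut] st.
have [exy|nxy] := eqVneq x y.
  subst y; move: st; rewrite perm_cons => st.
  have [p [pt ps] op] := IH _ Ut st.
  have px : p x = x by rewrite (out_perm pt) ?inE.
  exists p; last first.
    rewrite op (seq.permP st).
    by move: (odd _) (inversions s) (inversions t); do 3!case.
  split; last by rewrite px ps.
  apply: subset_trans pt _; apply/subsetP => z.
  by rewrite !inE => ->; rewrite orbT.
have yt : y \in t.
  by have := perm_mem st y; rewrite !inE eqxx eq_sym (negbTE nxy) => /esym.
move: xt Ut st; case/splitPr: yt => a b.
rewrite mem_cat inE !negb_or => /and3P[xa _ xb].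
rewrite -cat1s uniq_catCA /= mem_cat negb_or => /andP[/andP[ya yb] Uab] st.
have sab : perm_eq s (a ++ x :: b).
  rewrite -(perm_cons y) (perm_trans st) //; apply/seq.permP => P.
  by rewrite /= !count_cat /= addnCA [RHS]addnCA (addnCA (P x)).
have Uaxb : uniq (a ++ x :: b).
  by rewrite -cat1s uniq_catCA /= mem_cat negb_or xa xb.
have [p [pt ps] op] := IH _ Uaxb sab.
have py : p y = y.
  by rewrite (out_perm pt) // inE mem_cat inE !negb_or ya yb eq_sym nxy.
have tid c : x \notin c -> y \notin c -> map (tperm x y * p)%g c = map p c.
  move=> xc yc; apply/eq_in_map => z zc; rewrite permM tpermD //.
    by apply: contraNneq xc => ->.
  by apply: contraNneq yc => ->.
exists (tperm x y * p)%g; last first.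
  (* Exactly one of x < y and y < x holds: this is the sign of the exchange. *)
  rewrite odd_mul_tperm nxy op /= (seq.permP sab) !inversions_remove //.
  rewrite !count_cat /= !oddD !oddb (prec_neq nxy).
  move: (prec x y) (odd _) (odd _) (odd _) (odd _) (odd _).
  move: (inversions _) (inversions _).
  by do 8!case.
split; last first.
  rewrite permM tpermL py map_cat /= tid // tid // permM tpermR.
  by rewrite -ps map_cat.
apply/subsetP => z; rewrite !inE permM !mem_cat !inE.
have [->|nzx] := eqVneq z x; first by rewrite ?orbT.
have [->|nzy] := eqVneq z y; first by rewrite ?orbT.
have -> : tperm x y z = z by rewrite tpermD // eq_sym.
move=> pz; have := subsetP pt z pz; rewrite !inE mem_cat inE (negbTE nzx).
by case/orP => ->; rewrite ?orbT.
Qed.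

(** The permutation that carries [t] to [s] and fixes the rest is unique, so
the existential in [same_orientation] tests its parity. *)
Lemma same_orientationE s t : uniq t -> perm_eq s t ->
  same_orientation s t = (inversions s == inversions t).
Proof.
move=> Ut st; have [p [pt ps] op] := orienting_perm Ut st.
apply/existsP/idP => [[q /and3P[qt /eqP qs oq]]|]; last first.
  move=> /eqP e; exists p; rewrite pt ps eqxx op e.
  by rewrite addbb.
suff eqp : q = p.
  by move: oq; rewrite eqp op; case: inversions; case: inversions.
apply/permP => x; have [xt|xt] := boolP (x \in t); last first.
  by rewrite (out_perm qt) ?(out_perm pt) // inE.
by apply: (eq_in_map q p t).2; rewrite // qs ps.
Qed.
End Inversions.

(** * Boundary and coboundary on the full simplex *)

Section Clifford.
Variables (R : realType) (T : finType).
Implicit Types (x y : T) (E F : {set T}) (f g : {set T} -> R).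

(** The sign with which [E] occurs in the boundary of [x |: E], when the
vertices are listed in increasing order. *)
Definition pos_sign E x : R := (-1) ^+ (\sum_(y in E) prec y x)%N.

Lemma pos_signU1 E x y : x \notin E ->
  pos_sign (x |: E) y = (-1) ^+ prec x y * pos_sign E y.
Proof.
by move=> xE; rewrite /pos_sign big_setU1 // exprD. Qed.

Lemma pos_sign_id E x : pos_sign (x |: E) x = pos_sign E x.
Proof.
have [xE|xE] := boolP (x \in E); first by rewrite (setUidPr _) ?sub1set.
by rewrite pos_signU1 // precxx mul1r.
Qed.

Lemma pos_sign_sqr E x : pos_sign E x * pos_sign E x = 1.
Proof. by rewrite -expr2 sqrr_sign. Qed.

Definition contract x f E : R :=
  if x \in E then 0 else pos_sign E x * f (x |: E).
Definition wedge x f F : R :=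
  if x \in F then pos_sign F x * f (F :\ x) else 0.

(** The Clifford relations.  For distinct [x] and [y], the two composites
remove [y] and insert [x] in either order; the signs differ by
[prec x y (+) prec y x], so they cancel. *)
Lemma contract_wedge x y f E :
  contract x (wedge y f) E + wedge y (contract x f) E =
    if y == x then f E else 0.
Proof.
have [<-|nxy] := eqVneq x y.
  rewrite /contract /wedge !inE eqxx /=; have [xE|xE] := boolP (x \in E).
    by rewrite setD1K // add0r -{1}(setD1K xE) pos_sign_id mulrA
      pos_sign_sqr mul1r.
  by rewrite setU1K // addr0 pos_sign_id mulrA pos_sign_sqr mul1r.
rewrite /contract /wedge !inE (negbTE nxy) eq_sym (negbTE nxy) /=.
have [xE|xE] := boolP (x \in E); have [yE|yE] := boolP (y \in E);
  rewrite ?mulr0 ?addr0 //.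
have ysub : y \notin E :\ y by rewrite !inE eqxx.
have -> : (x |: E) :\ y = x |: E :\ y.
  apply/setP => z; rewrite !inE; case: eqVneq => // ->.
  by rewrite eq_sym (negbTE nxy).
have -> : pos_sign E x = (-1) ^+ prec y x * pos_sign (E :\ y) x.
  by rewrite -pos_signU1 // setD1K.
by rewrite pos_signU1 // (prec_neq nxy); case: prec; rewrite /= expr0 expr1; ring.
Qed.

Lemma reindex_setU1 x (G : {set T} -> R) :
  \sum_(F : {set T} | x \in F) G (F :\ x) = \sum_(E : {set T} | x \notin E) G E.
Proof.
rewrite [RHS](reindex_onto (fun F => F :\ x) (fun E => x |: E)); last first.
  by move=> E xE; rewrite setU1K.
apply: eq_bigl => F; rewrite !inE eqxx /=.
apply/idP/eqP => [xF|<-]; first exact: setD1K.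
by rewrite setU11.
Qed.

Lemma wedge_adj x f g :
  \sum_E contract x f E * g E = \sum_F f F * wedge x g F.
Proof.
rewrite (bigID (fun E => x \in E)) /= big1 ?add0r; last first.
  by move=> E xE; rewrite /contract xE mul0r.
rewrite [RHS](bigID (fun E => x \in E)) /= [X in _ = _ + X]big1 ?addr0; last first.
  by move=> E /negbTE xE; rewrite /wedge xE mulr0.
rewrite -reindex_setU1; apply: eq_bigr => F xF.
rewrite /contract /wedge xF !inE eqxx /= setD1K //.
have -> : pos_sign F x = pos_sign (F :\ x) x.
  by rewrite -{1}(setD1K xF) pos_sign_id.
by rewrite mulrA (mulrC (f F)).
Qed.

Definition bd f E : R := \sum_x contract x f E.
Definition cobd f F : R := \sum_x wedge x f F.

Lemma cobd_adj f g : \sum_E bd f E * g E = \sum_F f F * cobd g F.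
Proof.
under eq_bigr do rewrite mulr_suml.
under [RHS]eq_bigr do rewrite mulr_sumr.
rewrite exchange_big [RHS]exchange_big.
by apply: eq_bigr => x _; exact: wedge_adj.
Qed.

(** The combinatorial Laplacian of a full simplex is the number of vertices
times the identity. *)
Lemma bd_cobd f E : bd (cobd f) E + cobd (bd f) E = #|T|%:R * f E.
Proof.
transitivity
  (\sum_x \sum_y (contract x (wedge y f) E + wedge y (contract x f) E)).
  under eq_bigr do rewrite big_split.
  rewrite big_split /=; congr (_ + _).
    apply: eq_bigr => x _; rewrite /contract.
    case: ifP => _; first by rewrite big1.
    by rewrite mulr_sumr.
  rewrite exchange_big; apply: eq_bigr => y _.
  by rewrite /wedge; case: ifP => _; [rewrite mulr_sumr | rewrite big1].
under eq_bigr do under eq_bigr do rewrite contract_wedge.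
under eq_bigr do rewrite -big_mkcond /= big_pred1_eq.
by rewrite sumr_const mulr_natl.
Qed.

Lemma bd_cobd_norm f :
  \sum_E bd f E ^+ 2 + \sum_E cobd f E ^+ 2 = #|T|%:R * \sum_E f E ^+ 2.
Proof.
have -> : \sum_E bd f E ^+ 2 = \sum_E f E * cobd (bd f) E.
  by rewrite -cobd_adj; apply: eq_bigr => E _; rewrite expr2.
have -> : \sum_E cobd f E ^+ 2 = \sum_E bd (cobd f) E * f E.
  by rewrite cobd_adj; apply: eq_bigr => E _; rewrite expr2.
rewrite -big_split /= mulr_sumr; apply: eq_bigr => E _.
by rewrite mulrC -mulrDl addrC bd_cobd -mulrA expr2.
Qed.

Definition sole_facet (S : {set {set T}}) F u :=
  (u \notin F) && [forall v in F, (u |: F) :\ v \notin S].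

(** Keep in the sum on the right only the sets [E] with a single facet in [S]:
there the coboundary is, up to sign, the value of [f] at that facet. *)
Lemma cobd_sole_facet (S : {set {set T}}) f :
    (forall F, F \notin S -> f F = 0) ->
  \sum_(F in S) #|[set u | sole_facet S F u]|%:R * f F ^+ 2 <=
    \sum_E cobd f E ^+ 2.
Proof.
move=> f0.
pose G u F := if (F \in S) && sole_facet S F u then f F ^+ 2 else 0.
have -> : \sum_(F in S) #|[set u | sole_facet S F u]|%:R * f F ^+ 2 =
    \sum_(E : {set T}) \sum_(u in E) G u (E :\ u).
  rewrite (exchange_big_dep predT) //=.
  transitivity (\sum_u \sum_(F : {set T} | u \notin F) G u F); last first.
    by apply: eq_bigr => u _; rewrite -reindex_setU1.
  rewrite (exchange_big_dep predT) //= [LHS]big_mkcond; apply: eq_bigr => F _.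
  rewrite /G; case: ifP => FS; last by rewrite big1.
  rewrite -big_mkcondr sumr_const /= mulr_natl; congr (_ *+ _).
  by apply: eq_card => u; rewrite !inE unfold_in /= /sole_facet; case: (u \in F).
apply: ler_sum => E _.
pose sole u := [&& u \in E, E :\ u \in S & sole_facet S (E :\ u) u].
have [[u uE]|none] := altP (@existsP _ sole).
  case/and3P: uE => uE uS ul.
  have other v : v \in E -> v != u -> E :\ v \notin S.
    move=> vE vu; case/andP: ul => _ /forall_inP/(_ v).
    by rewrite !inE vu vE setD1K //; apply.
  rewrite (bigD1 u) //= big1 ?addr0; last first.
    by move=> v /andP[vE vu]; rewrite /G (negbTE (other _ _ _)).
  rewrite /G uS ul /= /cobd (bigD1 u) //= big1 ?addr0; last first.
    move=> v vu; rewrite /wedge; case: ifP => // vE.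
    by rewrite f0 ?mulr0 ?other.
  by rewrite /wedge uE exprMn sqrr_sign mul1r.
rewrite big1 ?sqr_ge0 // => u uE; rewrite /G.
case: ifP => // h; move: none; rewrite negb_exists => /forallP/(_ u).
by rewrite /sole uE h.
Qed.

Lemma bd_norm_le (S : {set {set T}}) f : (forall F, F \notin S -> f F = 0) ->
  \sum_E bd f E ^+ 2 <=
    \sum_(F in S) #|[set u | ~~ sole_facet S F u]|%:R * f F ^+ 2.
Proof.
move=> f0.
have := bd_cobd_norm f; move/(canRL (addrK _)) ->.
rewrite lerBlDr -lerBlDl; apply: le_trans (cobd_sole_facet f0).
rewrite lerBlDl mulr_sumr (bigID (mem S)) /= [X in _ + X]big1 ?addr0; last first.
  by move=> F FS; rewrite f0 // expr0n mulr0.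
rewrite -big_split ler_sum //= => F FS; rewrite -mulrDl -natrD.
rewrite -(cardsC [set u | ~~ sole_facet S F u]).
rewrite (_ : ~: _ = [set u | sole_facet S F u]) //.
by apply/setP => u; rewrite !inE negbK.
Qed.
End Clifford.

(** * The boundary matrix of an oriented complex *)

Section Bound.
Variables (R : realType) (T : finType) (K : {set {set T}}) (o : {set T} -> seq T).
Hypotheses (hK : simplicial_complex K) (ho : orientation K o).
Implicit Types (x y u v : T) (s t : seq T) (E F : {set T}) (k : nat).

Definition inv_sign s : R := (-1) ^+ inversions s.

Lemma perm_eq_set s t E : uniq s -> perm_eq t (enum E) ->
  perm_eq s t = ([set x in s] == E).
Proof.
move=> Us tE; apply/idP/eqP => [st|sE].
  apply/setP => x; rewrite inE (perm_mem st) (perm_mem tE).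
  exact: mem_enum.
have Ut : uniq t by rewrite (perm_uniq tE) enum_uniq.
apply: uniq_perm => // x; rewrite (perm_mem tE) mem_enum -sE inE.
by [].
Qed.

Lemma pos_sign_count s E x : perm_eq s (enum E) ->
  pos_sign R E x = (-1) ^+ odd (count (fun y => prec y x) s).
Proof.
move=> sE; rewrite signr_odd; congr (_ ^+ _).
rewrite (seq.permP sE) -sum1_count big_enum_cond /= [RHS]big_mkcondr /=.
by apply: eq_bigr => y _; case: prec.
Qed.

Lemma inv_sign_remove a x b : x \notin a ->
  (-1) ^+ size a * inv_sign (a ++ b) =
    inv_sign (a ++ x :: b) * (-1) ^+ odd (count (fun y => prec y x) (a ++ b)).
Proof.
move=> xa; rewrite /inv_sign inversions_remove // -[in LHS]signr_odd !signr_addb.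
by case: (odd (count _ _)); rewrite /= ?expr0 ?expr1; ring.
Qed.

Lemma enum_valK k (i : 'I_#|faces K k|) :
  enum_val i \in K /\ #|enum_val i| = k.+1.
Proof. by have := enum_valP i; rewrite inE => /andP[? /eqP]. Qed.

(** Up to the sign of the chosen orderings of the two faces, the entries are
those of the boundary operator for the fixed order on [T].  The sum on the
right has at most one term: the vertex [x] with [enum_val i :\ x] equal to
[enum_val j]. *)
Lemma boundaryE k (i : 'I_#|faces K k.+1|) (j : 'I_#|faces K k|) :
  boundary R K o k.+1 i j =
    inv_sign (o (enum_val i)) * inv_sign (o (enum_val j)) *
    \sum_(x in enum_val i | enum_val i :\ x == enum_val j)
       pos_sign R (enum_val j) x.
Proof.
set F := enum_val i; set E := enum_val j.
have [FK cF] := enum_valK i; have [EK cE] := enum_valK j.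
have oF := ho FK; have oE := ho EK; rewrite -/F -/E in FK cF EK cE oF oE.
have Us : uniq (o F) by rewrite (perm_uniq oF) enum_uniq.
have oFm y : (y \in F) = (y \in o F) by rewrite (perm_mem oF) mem_enum.
have ss : size (o F) = k.+2 by rewrite (perm_size oF) -cardE.
have [x0 _] : exists x, x \in F by apply/card_gt0P; rewrite cF.
rewrite mxE summxE mulr_sumr big_mkcondr /=.
rewrite -[RHS]big_enum /= -(perm_big _ oF) (big_nth x0) big_mkord ss /=.
apply: eq_bigr => n _; rewrite !mxE -/E -/F.
set x := nth x0 (o F) n; set a := take n _; set b := drop _ _.
have ltn : (n < size (o F))%N by rewrite ss.
have Ds : o F = a ++ x :: b by rewrite -drop_nth // cat_take_drop.
have sa : size a = n by rewrite size_takel // ltnW.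
move: (Us); rewrite Ds -cat1s uniq_catCA /= => /andP[xab Uab].
have xa : x \notin a by apply: contra xab; rewrite mem_cat => ->.
rewrite (perm_eq_set Uab oE).
have -> : [set y in a ++ b] = F :\ x.
  apply/setP => y; rewrite !inE oFm Ds !mem_cat inE.
  by case: eqVneq => //= ->; apply/negbTE; rewrite -mem_cat.
case: eqP => FE; last by rewrite mulr0.
have abE : perm_eq (a ++ b) (o E).
  rewrite (perm_eq_set Uab oE) -FE; apply/eqP.
  apply/setP => y; rewrite !inE oFm Ds !mem_cat inE.
  by case: eqVneq => //= ->; apply/negbTE; rewrite -mem_cat.
have UE : uniq (o E) by rewrite (perm_uniq oE) enum_uniq.
rewrite same_orientationE //.
have -> : (if inversions (a ++ b) == inversions (o E) then 1 else -1) =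
    inv_sign (a ++ b) * inv_sign (o E) :> R.
  by rewrite /inv_sign; case: inversions; case: inversions;
     rewrite /= ?expr0 ?expr1 ?mulrNN ?mulr1 ?mul1r.
rewrite mulrA -{1}sa (inv_sign_remove _ xa) -Ds mulrAC (@pos_sign_count (a ++ b)) //.
exact: perm_trans abE oE.
Qed.

(** The chain [w] in the basis of increasingly ordered faces, extended by zero
to all subsets. *)
Definition chain_fun k (w : 'rV[R]_#|faces K k|) F : R :=
  \sum_(i | enum_val i == F) inv_sign (o F) * w 0 i.

Lemma chain_fun_out k (w : 'rV_#|faces K k|) F :
  F \notin faces K k -> chain_fun w F = 0.
Proof.
move=> FS; rewrite /chain_fun big1 // => i /eqP iF.
by rewrite -iF enum_valP in FS.
Qed.

Lemma chain_fun_sqr k (w : 'rV_#|faces K k|) i :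
  chain_fun w (enum_val i) ^+ 2 = w 0 i ^+ 2.
Proof.
rewrite /chain_fun (big_pred1 i) => [|j]; last by rewrite (inj_eq enum_val_inj).
by rewrite exprMn sqrr_sign mul1r.
Qed.

Lemma bd_chain_fun k (w : 'rV_#|faces K k.+1|) j :
  (w *m boundary R K o k.+1) 0 j =
    inv_sign (o (enum_val j)) * bd (chain_fun w) (enum_val j).
Proof.
rewrite mxE /bd; set E := enum_val j.
under eq_bigr do rewrite boundaryE -/E mulr_sumr mulr_sumr.
rewrite (exchange_big_dep predT) //= mulr_sumr; apply: eq_bigr => x _.
rewrite /contract; case: ifP => xE.
  rewrite mulr0 big1 // => i /andP[_ /eqP FE].
  by rewrite -FE !inE eqxx in xE.
rewrite /chain_fun 2!mulr_sumr; apply: eq_big => [i|i /andP[xF /eqP <-]].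
  apply/andP/eqP => [[xF /eqP <-]|->]; first by rewrite setD1K.
  by rewrite setU11 setU1K ?xE.
rewrite setD1K //; ring.
Qed.

(** If [u] is not in [F], a second facet [(u |: F) :\ v] that is a face
exhibits [u] as a neighbour of [F :\ v]. *)
Lemma not_sole_facet_nbrs k F : F \in faces K k.+1 ->
  [set u | ~~ sole_facet (faces K k.+1) F u] \subset
    \bigcup_(E in facets K k.+1 F) nbrs K k.+1 E.
Proof.
move=> FS; have [FK cF] : F \in K /\ #|F| = k.+2.
  by move: FS; rewrite inE => /andP[? /eqP].
have facetP v : v \in F -> F :\ v \in facets K k.+1 F.
  move=> vF; rewrite !inE subsetDl andbT (hK FK) ?subsetDl //=.
  by rewrite -eqSS -cF (cardsD1 v F) vF.
apply/subsetP => u; rewrite inE /sole_facet negb_and negbK.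
have [uF _|uF] /= := boolP (u \in F).
  apply/bigcupP; exists (F :\ u); first exact: facetP.
  have uK : [set u] \in K by rewrite (hK FK) ?sub1set.
  by rewrite inE setD1K // FS !inE eqxx uK.
rewrite negb_forall_in => /exists_inP[v vF]; rewrite negbK => S'.
apply/bigcupP; exists (F :\ v); first exact: facetP.
have vu : v != u by apply: contraNneq uF => <-.
have Du : (u |: F) :\ v = u |: F :\ v.
  by apply/setP => z; rewrite !inE; case: eqVneq => // ->; rewrite (negbTE vu).
rewrite Du in S'; rewrite inE S' andbT !inE (negbTE uF) andbF /=.
by move: S'; rewrite inE => /andP[/hK ->] //; rewrite sub1set setU11.
Qed.

Lemma boundary_norm_le k (w : 'rV_#|faces K k.+1|) :
  \sum_j (w *m boundary R K o k.+1) 0 j ^+ 2 <=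
    (\max_(F in faces K k.+1) #|\bigcup_(E in facets K k.+1 F) nbrs K k.+1 E|)%:R
      * \sum_i w 0 i ^+ 2.
Proof.
apply: (@le_trans _ _ (\sum_E bd (chain_fun w) E ^+ 2)).
  rewrite [leRHS](bigID (mem (faces K k))) /= -[leLHS]addr0 lerD //; last first.
    by apply: sumr_ge0 => E _; exact: sqr_ge0.
  rewrite [leRHS]big_enum_val /=; apply: ler_sum => j _.
  by rewrite bd_chain_fun exprMn sqrr_sign mul1r.
apply: le_trans (bd_norm_le (@chain_fun_out k.+1 w)) _.
rewrite [leLHS]big_enum_val mulr_sumr; apply: ler_sum => i _.
rewrite chain_fun_sqr ler_wpM2r ?sqr_ge0 // ler_nat.
apply: leq_trans (leq_bigmax_cond _ (enum_valP i)).
exact/subset_leq_card/not_sole_facet_nbrs/enum_valP.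
Qed.
End Bound.

(** * From a norm bound to the largest eigenvalue *)

Lemma rV_mulmx_tr (R : realType) n (v : 'rV[R]_n) :
  (v *m v^T) 0 0 = \sum_i v 0 i ^+ 2.
Proof. by rewrite mxE; apply: eq_bigr => i _; rewrite mxE expr2. Qed.

(** If [v] is an eigenvector of [B^T *m B] for [a], then [w = v *m B^T] has
[w *m B = a *: v] and squared norm [a] times that of [v]; the hypothesis on
[w] then reads [a <= c] when [a] is positive, and [0 <= c] covers the rest. *)
Lemma lambda_max_gram_le (R : realType) m n (B : 'M[R]_(m, n)) (c : R) : 0 <= c ->
  (forall w : 'rV_m, \sum_j (w *m B) 0 j ^+ 2 <= c * \sum_i w 0 i ^+ 2) ->
  lambda_max (B^T *m B) <= c.
Proof.
move=> c0 hB; rewrite /lambda_max.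
have ub a : eigenvalue (B^T *m B) a -> a <= c.
  case/eigenvalueP => v va v0; have [a0|a0] := leP a 0; first exact: le_trans c0.
  pose w := v *m B^T.
  have wB : w *m B = a *: v by rewrite -mulmxA.
  have nw : \sum_i w 0 i ^+ 2 = a * \sum_i v 0 i ^+ 2.
    by rewrite -!rV_mulmx_tr trmx_mul trmxK mulmxA wB -scalemxAl mxE.
  have := hB w; rewrite wB nw.
  have -> : \sum_j (a *: v) 0 j ^+ 2 = a * (a * \sum_j v 0 j ^+ 2).
    by rewrite mulrA mulr_sumr; apply: eq_bigr => j _; rewrite mxE exprMn expr2.
  have v_gt0 : 0 < \sum_i v 0 i ^+ 2.
    rewrite lt0r sumr_ge0 ?andbT => [|i _]; last exact: sqr_ge0.
    apply: contra v0; rewrite psumr_eq0 => [/allP h|i _]; last exact: sqr_ge0.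
    apply/eqP/rowP => i; rewrite mxE; apply/eqP.
    by have := h i (mem_index_enum i); rewrite /= sqrf_eq0.
  by rewrite ler_pM2r // mulr_gt0.
(* An empty spectrum, as for n = 0, has supremum 0 by convention. *)
have [[ne _]|/sup_out -> //] :=
  boolp.pselect (classical_sets.has_sup (fun a : R => eigenvalue (B^T *m B) a)).
exact: ge_sup.
Qed.

Theorem theorem4p2 (R : realType) (T : finType) (K : {set {set T}})
    (o : {set T} -> seq T) (r : nat)
    (hK : simplicial_complex K) (ho : orientation K o)
    (hr : (1 <= r)%N) (hdim : complex_dim K = r) :
  lambda_max (up_laplacian R K o r.-1) <=
    (\max_(F in faces K r) #|\bigcup_(E in facets K r F) nbrs K r E|)%:R.
Proof.
case: r hr {hdim} => // k _.
by apply: lambda_max_gram_le => // w; exact: boundary_norm_le.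
Qed.
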